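(* Let $J,R,Q\in\mathbb{C}^{n,n}$ with $J^*=-J$, $R^*=R\succeq 0$ and $Q^*=Q\succ 0$ be such that the system $\dot x(t)=(J-R)Qx(t)$ is asymptotically stable. Let $B\in\mathbb{C}^{n,r}$ be of full column rank. For $w\in\mathbb{R}$, define $\Omega_w:=\operatorname{null}\left((I_n-BB^\dagger)(iwI_n-(J-R)Q)\right)$. Suppose that $\Omega_w\neq\{0\}$ for some $w\in\mathbb{R}$. Then $$r_{\mathbb{C}}^{S_d}(J,R;B)^2\geq\inf_{w\in\mathbb{R}}\ \inf_{x\in\Omega_w,\ B^*Qx\neq 0}\left\{\frac{2\|B^\dagger(iwI_n-(J-R)Q)x\|^2}{\|B^*Qx\|^2}-\frac{|x^*Q(iwI_n-(J-R)Q)x|^2}{\|B^*Qx\|^4}\right\}.$$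
   Context: $A\succeq 0$ (resp. $\succ 0$, $\preceq 0$) means Hermitian positive semidefinite (resp. positive definite, negative semidefinite). $B^\dagger$ is the Moore-Penrose pseudoinverse, $\|\cdot\|$ is the Euclidean norm of a vector, $\|\cdot\|_F$ the Frobenius norm, and $\Lambda(A)$ the set of eigenvalues of $A$. The system $\dot x=Ax$ is asymptotically stable if all eigenvalues of $A$ lie in the open left half of the complex plane. Define $$S_d^{\mathbb{C}}(J,R;B)=\{(\Delta_J,\Delta_R)\in(\mathbb{C}^{r,r})^2:\Delta_J^*=-\Delta_J,\ \Delta_R\preceq 0,\ R+B\Delta_RB^*\succeq 0\}.$$ The structured stability radius is $$r_{\mathbb{C}}^{S_d}(J,R;B)=\inf\Big\{\sqrt{\|\Delta_J\|_F^2+\|\Delta_R\|_F^2}:(\Delta_J,\Delta_R)\in S_d^{\mathbb{C}}(J,R;B),\ \Lambda\big((J-R)Q+B(\Delta_J-\Delta_R)B^*Q\big)\cap i\mathbb{R}\neq\emptyset\Big\}.$$ The infimum of the empty set is $+\infty$. *)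

(* Defs.v *)
From HB Require Import structures.
From mathcomp Require Import all_boot all_order all_algebra complex.
From mathcomp Require Import all_classical all_reals ereal.

Set Implicit Arguments.
Unset Strict Implicit.
Unset Printing Implicit Defensive.

Import Order.TTheory GRing.Theory Num.Theory ComplexField.

Local Open Scope classical_set_scope.
Local Open Scope ring_scope.
Local Open Scope sesquilinear_scope.

Section StabilityRadius.
Variable K : realType.
Local Notation C := K[i].

(* The order of [K[i]] is the partial one: [0 <= z] says that [z] is a
   nonnegative real number. *)
Definition posdefmx n (A : 'M[C]_n) : Prop :=
  A ^t* = A /\ forall x : 'cV[C]_n, x != 0 -> 0 < (x ^t* *m A *m x) 0 0.

Definition possemidefmx n (A : 'M[C]_n) : Prop :=
  A ^t* = A /\ forall x : 'cV[C]_n, 0 <= (x ^t* *m A *m x) 0 0.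

Definition negsemidefmx n (A : 'M[C]_n) : Prop :=
  A ^t* = A /\ forall x : 'cV[C]_n, (x ^t* *m A *m x) 0 0 <= 0.

(* [Normc.normc] is the complex modulus with values in [K]. *)
Definition eucl_norm n (x : 'cV[C]_n) : K :=
  Num.sqrt (\sum_i Normc.normc (x i 0) ^+ 2).

Definition frob_norm m n (A : 'M[C]_(m, n)) : K :=
  Num.sqrt (\sum_i \sum_j Normc.normc (A i j) ^+ 2).

Definition penrose m n (A : 'M[C]_(m, n)) (X : 'M[C]_(n, m)) : Prop :=
  [/\ A *m X *m A = A, X *m A *m X = X,
      (A *m X) ^t* = A *m X & (X *m A) ^t* = X *m A].

(* The chosen matrix is the only one satisfying the Penrose equations: see
   [mpinvP] and [penrose_uniq] below. *)
Definition mpinv m n (A : 'M[C]_(m, n)) : 'M[C]_(n, m) :=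
  xget 0 [set X | penrose A X].

(* A space of column vectors, whereas [kermx] is the row kernel. *)
Definition null m n (A : 'M[C]_(m, n)) : set 'cV[C]_n :=
  [set x | A *m x = 0].

(* [eigenvalue] is about row eigenvectors; the set of eigenvalues is the same. *)
Definition spectrum n (A : 'M[C]_n) : set C := [set z | eigenvalue A z].

Definition imaginary_axis : set C := [set z | complex.Re z = 0].

Definition asymptotically_stable n (A : 'M[C]_n) : Prop :=
  forall z, spectrum A z -> complex.Re z < 0.

Definition Sd n r (J R : 'M[C]_n) (B : 'M[C]_(n, r)) :
    set ('M[C]_r * 'M[C]_r) :=
  [set D | [/\ D.1 ^t* = - D.1, negsemidefmx D.2
             & possemidefmx (R + B *m D.2 *m B ^t*)]].

Definition stab_radius_Sd n r (J R Q : 'M[C]_n) (B : 'M[C]_(n, r)) : \bar K :=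
  ereal_inf [set (Num.sqrt (frob_norm D.1 ^+ 2 + frob_norm D.2 ^+ 2))%:E
    | D in [set D | Sd J R B D /\
        spectrum ((J - R) *m Q + B *m (D.1 - D.2) *m B ^t* *m Q)
          `&` imaginary_axis !=set0]].

Definition shifted n (J R Q : 'M[C]_n) (w : K) : 'M[C]_n :=
  (0 +i* w)%C%:M - (J - R) *m Q.

Definition Omega n r (J R Q : 'M[C]_n) (B : 'M[C]_(n, r)) (w : K) :
    set 'cV[C]_n :=
  null ((1%:M - B *m mpinv B) *m shifted J R Q w).

Section MoorePenrose.

Lemma gram_unitmx m n (F : 'M[C]_(m, n)) :
  row_free F -> F *m F ^t* \in unitmx.
Proof.
move=> Ffree; rewrite -row_free_unit -kermx_eq0; apply/eqP/row_matrixP => i.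
rewrite row0; set u := row i _.
have uFF : u *m (F *m F ^t*) = 0.
  by rewrite /u -row_mul mulmx_ker row0.
have uF : u *m F = 0.
  apply/eqP; apply/negPn/negP => /dotmx_is_dotmx.
  by rewrite dotmxE trmx_mul map_mxM mulmxA -(mulmxA u) uFF mul0mx mxE ltxx.
by apply/eqP; rewrite -(mulmx_free_eq0 _ Ffree) uF.
Qed.

Lemma trmxC_mul m n p (A : 'M[C]_(m, n)) (B : 'M[C]_(n, p)) :
  (A *m B) ^t* = B ^t* *m A ^t*.
Proof. by rewrite trmx_mul map_mxM. Qed.

Lemma penrose_uniq m n (A : 'M[C]_(m, n)) (X Y : 'M[C]_(n, m)) :
  penrose A X -> penrose A Y -> X = Y.
Proof.
move=> [AXA XAX AX XA] [AYA YAY AY YA].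
have eAX : A *m X = A *m Y *m (A *m X) by rewrite mulmxA AYA.
have eYA : Y *m A = Y *m A *m (X *m A) by rewrite -!mulmxA [A *m (X *m A)]mulmxA AXA.
have AXY : A *m X = A *m Y.
  by rewrite -AX eAX trmxC_mul AX AY mulmxA AXA.
have YXA : Y *m A = X *m A.
  by rewrite -YA eYA trmxC_mul XA YA -!mulmxA [A *m (Y *m A)]mulmxA AYA.
by rewrite -XAX -YXA -mulmxA AXY mulmxA YAY.
Qed.

Lemma penrose_exists m n (A : 'M[C]_(m, n)) : exists X, penrose A X.
Proof.
have := mulmx_base A; have := row_base_free A; have := col_base_full A.
move: (col_base A) (row_base A) => G F Gfull Ffree <-.
have Fu := gram_unitmx Ffree.
have Gu : G ^t* *m G \in unitmx.
  have := @gram_unitmx _ _ (G ^t*); rewrite trmxCK; apply.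
  by rewrite /row_free mxrank_map mxrank_tr.
set iF := invmx (F *m F ^t*); set iG := invmx (G ^t* *m G).
have FH : F *m (F ^t* *m iF) = 1%:M by rewrite mulmxA mulmxV.
have GH : iG *m G ^t* *m G = 1%:M by rewrite -mulmxA mulVmx.
have iGh : iG ^t* = iG by rewrite /iG trmx_inv map_invmx trmxC_mul trmxCK.
have iFh : iF ^t* = iF by rewrite /iF trmx_inv map_invmx trmxC_mul trmxCK.
have AX : G *m F *m (F ^t* *m iF *m (iG *m G ^t*)) = G *m (iG *m G ^t*).
  by rewrite -(mulmxA G F) (mulmxA F) FH mul1mx.
have XA : F ^t* *m iF *m (iG *m G ^t*) *m (G *m F) = F ^t* *m iF *m F.
  by rewrite -(mulmxA (F ^t* *m iF)) (mulmxA _ G F) GH mul1mx.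
exists (F ^t* *m iF *m (iG *m G ^t*)); split.
- by rewrite AX -(mulmxA G) (mulmxA _ G F) GH mul1mx.
- by rewrite XA -(mulmxA _ F) (mulmxA F) FH mul1mx.
- by rewrite AX !trmxC_mul trmxCK iGh mulmxA.
- by rewrite XA !trmxC_mul trmxCK iFh mulmxA.
Qed.

Lemma mpinvP m n (A : 'M[C]_(m, n)) : penrose A (mpinv A).
Proof. by have [X AX] := penrose_exists A; exact: (xgetPex 0 (ex_intro _ X AX)). Qed.

End MoorePenrose.
End StabilityRadius.

(* Main.v *)
Require Import Defs.
From HB Require Import structures.
From mathcomp Require Import all_boot all_order all_algebra complex.
From mathcomp Require Import all_classical all_reals ereal.
From mathcomp Require Import ring lra.
Import Order.TTheory GRing.Theory Num.Theory ComplexField.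

Local Open Scope classical_set_scope.
Local Open Scope ring_scope.
Local Open Scope sesquilinear_scope.

(** Fix an admissible perturbation [(D1, D2)] that puts the eigenvalue [i w] on
    the imaginary axis, and let [D = D1 - D2], [S = i w - (J - R) Q] and
    [G = B^* Q S^-1 B], the transfer matrix at frequency [w].  An eigenvector
    [x] gives [u = B^* Q x] with [G (D u) = u].  Because [J + B D1 B^*] is
    skew-Hermitian and [R + B D2 B^*] is positive semidefinite, purely imaginary
    motion is only possible if the perturbed dissipation annihilates [Q x]; this
    makes [Q x] a left eigenvector as well, which reads [G^* (D^* u) = u]
    ([perturbed_eigenvector]).

    The expression to be minimised, evaluated at [x = S^-1 B v], depends only on
    [v] and [g = G v]: it is
    [q v g = 2 |v|^2 / |g|^2 - |<g, v>|^2 / |g|^4] ([objective_transfer]).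
    The two relations above supply one point for [G], namely [D u], and one for
    [G^*], namely [D^* u].  Splitting [D] along [u] shows that the average of the
    two values of [q] is at most [|D|_F^2] ([sqnorm_two_sided]), which is
    [|D1|_F^2 + |D2|_F^2] since the skew-Hermitian and Hermitian parts are
    orthogonal ([sqnorm_skew_herm]).  So one of the two values is at most
    [|D|_F^2].

    The value for [G] may be the large one, since [u] need not be optimal, and
    then a different point of [G] has to be found.  It exists because the infimum
    of [q] is the same for [G] and [G^*] ([bound_quotient_adj]).  Indeed
    completing the square gives
    [q v g = min_z 2 (|v - z g|^2 / |g|^2 + |z|^2)], so for fixed [z] the question
    is how small [|(1 - z G) v| / |G v|] can be.  For invertible [G] that is the
    least singular value of [G^-1 - z], which does not change under the adjoint;
    a duality argument covers singular [G]. *)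

Section StructuredPerturbation.
Context {K : realType}.
Local Notation C := K[i].
Implicit Types (m n p : nat).
Set Implicit Arguments.
Unset Strict Implicit.
Unset Printing Implicit Defensive.

(** * The Frobenius inner product *)

(** The trace form covers column vectors and square matrices at once, so that
    the Euclidean and the Frobenius norm share one calculus. *)
Definition inner {m n} (X Y : 'M[C]_(m, n)) : C := \tr (X ^t* *m Y).

(** Real-valued, as needed for order arguments: the self-product of [X] is the
    embedding of this number ([inner_sqnorm]). *)
Definition sqnorm {m n} (X : 'M[C]_(m, n)) : K := complex.Re (inner X X).

Lemma normc_sqr (z : C) :
  Normc.normc z ^+ 2 = complex.Re z ^+ 2 + complex.Im z ^+ 2.
Proof. by case: z => a b; rewrite sqr_sqrtr // addr_ge0 // sqr_ge0. Qed.

Lemma sqnormE m n (X : 'M[C]_(m, n)) :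
  sqnorm X = \sum_i \sum_j Normc.normc (X i j) ^+ 2.
Proof.
rewrite /sqnorm /inner /mxtrace raddf_sum exchange_big /=; apply: eq_bigr => j _.
rewrite mxE raddf_sum; apply: eq_bigr => i _; rewrite !mxE normc_sqr.
by case: (X i j) => a b /=; ring.
Qed.

Lemma sqnorm_ge0 m n (X : 'M[C]_(m, n)) : 0 <= sqnorm X.
Proof.
by rewrite sqnormE !sumr_ge0 // => i _; rewrite sumr_ge0 // => j _; rewrite sqr_ge0.
Qed.

Lemma sqnorm_eq0 m n (X : 'M[C]_(m, n)) : (sqnorm X == 0) = (X == 0).
Proof.
apply/eqP/eqP => [|->]; last by rewrite /sqnorm /inner mulmx0 mxtrace0.
rewrite sqnormE => X0; apply/matrixP => i j; rewrite mxE.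
have ge0 k : 0 <= \sum_l Normc.normc (X k l) ^+ 2.
  by rewrite sumr_ge0 // => l _; rewrite sqr_ge0.
have /(_ i isT) Xi0 := psumr_eq0P (fun k _ => ge0 k) X0.
have /(_ j isT) /eqP := psumr_eq0P (fun l _ => sqr_ge0 (Normc.normc (X i l))) Xi0.
by rewrite sqrf_eq0 => /eqP/Normc.eq0_normc.
Qed.

Lemma sqnorm_gt0 m n (X : 'M[C]_(m, n)) : (0 < sqnorm X) = (X != 0).
Proof. by rewrite lt_def sqnorm_ge0 andbT sqnorm_eq0. Qed.

Lemma eucl_norm_sqr n (x : 'cV[C]_n) : eucl_norm x ^+ 2 = sqnorm x.
Proof.
rewrite sqr_sqrtr; last by rewrite sumr_ge0 // => i _; rewrite sqr_ge0.
by rewrite sqnormE; apply: eq_bigr => i _; rewrite big_ord1.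
Qed.

Lemma frob_norm_sqr m n (X : 'M[C]_(m, n)) : frob_norm X ^+ 2 = sqnorm X.
Proof. by rewrite sqr_sqrtr -sqnormE // sqnorm_ge0. Qed.

Lemma innerC m n (X Y : 'M[C]_(m, n)) : inner X Y = (inner Y X)^*%C.
Proof.
rewrite -[RHS]/(Num.conj (inner Y X)) /inner -trace_map_mx -[RHS]mxtrace_tr.
by rewrite map_trmx trmxC_mul trmxCK.
Qed.

Lemma inner_sqnorm m n (X : 'M[C]_(m, n)) : inner X X = (sqnorm X)%:C%C.
Proof.
rewrite /sqnorm; have := innerC X X; case: (inner X X) => a b [] /eqP.
by rewrite -addr_eq0 -mulr2n mulrn_eq0 => /eqP ->.
Qed.

Lemma innerBr m n (X Y Z : 'M[C]_(m, n)) : inner X (Y - Z) = inner X Y - inner X Z.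
Proof. by rewrite /inner mulmxBr raddfB. Qed.

Lemma innerZr m n (z : C) (X Y : 'M[C]_(m, n)) : inner X (z *: Y) = z * inner X Y.
Proof. by rewrite /inner -scalemxAr mxtraceZ. Qed.

Lemma inner_mull m n p (A : 'M[C]_(p, m)) (X : 'M[C]_(m, n)) (Y : 'M[C]_(p, n)) :
  inner (A *m X) Y = inner X (A ^t* *m Y).
Proof. by rewrite /inner trmxC_mul mulmxA. Qed.

Lemma inner_mulr m n p (A : 'M[C]_(n, p)) (X : 'M[C]_(m, n)) (Y : 'M[C]_(m, p)) :
  inner (X *m A) Y = inner X (Y *m A ^t*).
Proof. by rewrite /inner trmxC_mul -mulmxA mxtrace_mulC -mulmxA. Qed.

Lemma inner_adj m n (X Y : 'M[C]_(m, n)) : inner (X ^t*) (Y ^t*) = inner Y X.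
Proof. by rewrite /inner trmxCK mxtrace_mulC. Qed.

Lemma sqnorm_adj m n (X : 'M[C]_(m, n)) : sqnorm (X ^t*) = sqnorm X.
Proof. by rewrite /sqnorm inner_adj. Qed.

Lemma inner_scalar n (x y : 'cV[C]_n) : x ^t* *m y = (inner x y)%:M.
Proof. by rewrite [LHS]mx11_scalar /inner /mxtrace big_ord1. Qed.

Lemma formE n (P : 'M[C]_n) (x : 'cV[C]_n) : (x ^t* *m P *m x) 0 0 = inner x (P *m x).
Proof. by rewrite -mulmxA inner_scalar mxE eqxx mulr1n. Qed.

Lemma sqnormBZ m n (X Y : 'M[C]_(m, n)) (z : C) :
  sqnorm (X - z *: Y) =
    sqnorm X - 2 * complex.Re (z * inner X Y) + Normc.normc z ^+ 2 * sqnorm Y.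
Proof.
have YXzY : inner Y (X - z *: Y) = (inner X Y)^*%C - z * (sqnorm Y)%:C%C.
  by rewrite innerBr innerZr -inner_sqnorm -innerC.
rewrite {1}/sqnorm innerBr innerZr (innerC _ X) (innerC _ Y) YXzY.
rewrite innerBr innerZr inner_sqnorm normc_sqr.
by case: z {YXzY} => a b; case: (inner X Y) => c d /=; ring.
Qed.

Lemma cauchy_schwarz m n (X Y : 'M[C]_(m, n)) :
  Normc.normc (inner X Y) ^+ 2 <= sqnorm X * sqnorm Y.
Proof.
have [->|Y0] := eqVneq Y 0.
  by rewrite /inner mulmx0 mxtrace0 Normc.normc0 expr0n mulr_ge0 ?sqnorm_ge0.
have Ygt0 : 0 < sqnorm Y by rewrite sqnorm_gt0.
rewrite -ler_pdivrMr // -subr_ge0.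
have := sqnorm_ge0 (X - ((sqnorm Y)^-1%:C%C * (inner X Y)^*%C) *: Y).
rewrite sqnormBZ !normc_sqr; move: (sqnorm X) (sqnorm Y) Ygt0 => x y y0.
case: (inner X Y) => a b /= h; apply: le_trans h _.
by rewrite le_eqVlt; apply/orP; left; apply/eqP; field; rewrite gt_eqF.
Qed.

Lemma skew_form n (A : 'M[C]_n) (y : 'cV[C]_n) : A ^t* = - A ->
  complex.Re (inner y (A *m y)) = 0.
Proof.
move=> As; have : inner (A *m y) y = - inner y (A *m y).
  by rewrite inner_mull As mulNmx /inner mulmxN linearN.
by rewrite innerC; case: (inner _ _) => a b /(congr1 (@complex.Re K)) /=; lra.
Qed.

Lemma herm_form n (A : 'M[C]_n) (y : 'cV[C]_n) : A ^t* = A ->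
  complex.Im (inner (A *m y) y) = 0.
Proof.
move=> Ah; have : inner (A *m y) y = (inner (A *m y) y)^*%C.
  by rewrite -innerC inner_mull Ah.
by case: (inner _ _) => a b /(congr1 (@complex.Im K)) /=; lra.
Qed.

Lemma sqnorm_skew_herm n (X Y : 'M[C]_n) : X ^t* = - X -> Y ^t* = Y ->
  sqnorm (X - Y) = sqnorm X + sqnorm Y.
Proof.
move=> Xs Yh.
have Re0 : complex.Re (inner X Y) = 0.
  have e : inner Y X = - inner X Y.
    by rewrite /inner Xs Yh mulNmx linearN opprK mxtrace_mulC.
  move: e; rewrite innerC; case: (inner X Y) => a b [/eqP].
  by rewrite -addr_eq0 -mulr2n mulrn_eq0 => /eqP.
by rewrite -[Y in LHS]scale1r sqnormBZ mul1r Re0 Normc.normc1 expr1n mul1r mulr0 subr0.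
Qed.

(** * Bessel inequalities for the Frobenius norm *)

(** Pythagoras for the rows of [X] and the line of [u]: the subtracted matrix is
    [X] composed with the orthogonal projection onto that line. *)
Lemma sqnorm_projr m n (X : 'M[C]_(m, n)) (u : 'cV[C]_n) : u != 0 ->
  sqnorm (X - ((sqnorm u)^-1)%:C%C *: (X *m u *m u ^t*)) =
    sqnorm X - sqnorm (X *m u) / sqnorm u.
Proof.
move=> u0; have U0 : sqnorm u != 0 by rewrite sqnorm_eq0.
rewrite sqnormBZ (innerC X) inner_mulr trmxCK inner_sqnorm.
have -> : sqnorm (X *m u *m u ^t*) = sqnorm (X *m u) * sqnorm u.
  rewrite {1}/sqnorm inner_mulr trmxCK -[X *m u *m _ *m _]mulmxA.
  have -> : u ^t* *m u = (sqnorm u)%:C%C%:M.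
    by rewrite inner_scalar inner_sqnorm.
  by rewrite mul_mx_scalar innerZr inner_sqnorm /=; ring.
by rewrite normc_sqr /=; field.
Qed.

Lemma sqnorm_mul_le m n (X : 'M[C]_(m, n)) (u : 'cV[C]_n) : u != 0 ->
  sqnorm (X *m u) / sqnorm u <= sqnorm X.
Proof. by move=> u0; rewrite -subr_ge0 -sqnorm_projr // sqnorm_ge0. Qed.

(** The minimised expression of the lower bound, in the variables
    [v = B^+ S x] and [g = B^* Q x]. *)
Definition bound_quotient n (v g : 'cV[C]_n) : K :=
  2 * sqnorm v / sqnorm g - Normc.normc (inner g v) ^+ 2 / sqnorm g ^+ 2.

(** In a unitary basis starting with [u / |u|], the first column and the first
    row of [D] have square norms [|D u|^2 / |u|^2] and [|D^* u|^2 / |u|^2] and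
    share the corner [<u, D u> / |u|^2]; together they carry at most [|D|_F^2].
    The corner has the same modulus for [D] and [D^*], so each quotient
    subtracts it once. *)
Lemma sqnorm_two_sided n (D : 'M[C]_n) (u : 'cV[C]_n) : u != 0 ->
  bound_quotient (D *m u) u + bound_quotient (D ^t* *m u) u <= 2 * sqnorm D.
Proof.
move=> u0; have U0 : sqnorm u != 0 by rewrite sqnorm_eq0.
(* The part of D off the first column still contains the first row without its
   corner. *)
have := sqnorm_mul_le ((D - ((sqnorm u)^-1)%:C%C *: (D *m u *m u ^t*)) ^t*) u0.
rewrite sqnorm_adj sqnorm_projr //.
have -> : (D - ((sqnorm u)^-1)%:C%C *: (D *m u *m u ^t*)) ^t* *m u
  = D ^t* *m u - (((sqnorm u)^-1)%:C%C * (inner u (D *m u))^*%C) *: u.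
  rewrite linearB /= map_mxB mulmxBl; congr (_ - _).
  rewrite linearZ /= map_mxZ trmxC_mul trmxCK -scalemxAl -scalerA.
  congr (_ *: _); first exact: conjc_real.
  by rewrite -mulmxA inner_scalar -innerC mul_mx_scalar.
rewrite /bound_quotient sqnormBZ (innerC u (D ^t* *m u)) !inner_mull trmxCK !normc_sqr.
case: (inner u _) => a b /=.
move: (sqnorm D) (sqnorm u) (sqnorm (D *m u)) (sqnorm (D ^t* *m u)) U0 => d U x y U0.
rewrite -subr_ge0 => h; rewrite -subr_ge0.
apply: le_trans (mulr_ge0 (ler0n K 2) h) _.
by rewrite le_eqVlt; apply/orP; left; apply/eqP; field.
Qed.

(** * The quotient is insensitive to taking adjoints *)

(** The difference of the two sides is [|<g, v> / |g|^2 - 2 z|^2]. *)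
Lemma bound_quotient_le n (v g : 'cV[C]_n) (z : C) : g != 0 ->
  bound_quotient v g <= 2 * (sqnorm (v - z *: g) / sqnorm g + Normc.normc z ^+ 2).
Proof.
rewrite -sqnorm_eq0 /bound_quotient sqnormBZ (innerC v) !normc_sqr => g0.
case: (inner g v) => c d; case: z => a b /=.
move: (sqnorm v) (sqnorm g) g0 => s t t0; rewrite -subr_ge0.
apply: le_trans (addr_ge0 (sqr_ge0 (c / t - 2 * a)) (sqr_ge0 (d / t - 2 * b))) _.
by rewrite le_eqVlt; apply/orP; left; apply/eqP; field.
Qed.

(** The minimum over [z] in [bound_quotient_le] is attained where that square
    vanishes. *)
Lemma bound_quotient_eq n (v g : 'cV[C]_n) : g != 0 -> exists z,
  bound_quotient v g = 2 * (sqnorm (v - z *: g) / sqnorm g + Normc.normc z ^+ 2).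
Proof.
rewrite -sqnorm_eq0 => g0; exists (((sqnorm g)^-1 / 2)%:C%C * inner g v).
rewrite /bound_quotient sqnormBZ (innerC v) !normc_sqr.
case: (inner g v) => c d /=.
by move: (sqnorm v) (sqnorm g) g0 => s t t0; field.
Qed.

(** Write the right-hand side with its optimal [z] as
    [2 (s + |z|^2)].  With [M = 1 - conj z G] this says
    [|M^* e|^2 = s |G^* e|^2], and a [v] with [|M v|^2 <= s |G v|^2] is wanted.
    A kernel vector of [M] will do; if [M] is invertible, [v = M^-1 u] with
    [u = G^* e] works because [G] and [M] commute, so that
    [<M^* e, G v> = <G^* e, u> = |u|^2], and Cauchy-Schwarz bounds this by
    [|M^* e| |G v|]. *)
Lemma bound_quotient_adj n (G : 'M[C]_n) (e : 'cV[C]_n) : G ^t* *m e != 0 ->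
  exists2 v, G *m v != 0
    & bound_quotient v (G *m v) <= bound_quotient e (G ^t* *m e).
Proof.
set u := G ^t* *m e => u0; have [z ->] : exists z : C, _ := bound_quotient_eq e u0.
set s := sqnorm (e - _) / sqnorm u; set M : 'M[C]_n := 1%:M - z^*%C *: G.
suff: exists2 v : 'cV[C]_n, G *m v != 0 & sqnorm (M *m v) <= s * sqnorm (G *m v).
  case=> v Gv0 hv.
  exists v => //; apply: le_trans (bound_quotient_le v z^*%C Gv0) _.
  have -> : v - z^*%C *: (G *m v) = M *m v by rewrite mulmxBl mul1mx scalemxAl.
  rewrite ler_pM2l // !normc_sqr.
  have -> : complex.Re z^*%C ^+ 2 + complex.Im z^*%C ^+ 2 =
      complex.Re z ^+ 2 + complex.Im z ^+ 2.
    by case: (z) => a b /=; rewrite sqrrN.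
  by rewrite lerD2r ler_pdivrMr ?sqnorm_gt0.
have Me : M ^t* *m e = e - z *: u.
  rewrite linearB /= map_mxB trmx1 map_mx1 linearZ /= map_mxZ mulmxBl mul1mx.
  by rewrite -scalemxAl /u; congr (_ - _ *: _); exact: conjcK.
have GM : G *m M = M *m G.
  by rewrite mulmxBl mulmxBr mul1mx mulmx1 -scalemxAl -scalemxAr.
have s0 : 0 <= s by rewrite divr_ge0 ?sqnorm_ge0.
have U0 : 0 < sqnorm u by rewrite sqnorm_gt0.
have [Mu|Mu] := boolP (M \in unitmx).
  have e'u : inner (M ^t* *m e) (G *m (invmx M *m u)) = (sqnorm u)%:C%C.
    rewrite inner_mull trmxCK mulmxA -GM -mulmxA mulKVmx //.
    by rewrite -[G]trmxCK -inner_mull inner_sqnorm.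
  have h0 : G *m (invmx M *m u) != 0.
    apply: contraTneq U0 => h0; rewrite -leNgt.
    by move: e'u; rewrite h0 /inner mulmx0 mxtrace0 => -[<-].
  exists (invmx M *m u) => //; rewrite mulKVmx //.
  have := cauchy_schwarz (M ^t* *m e) (G *m (invmx M *m u)).
  rewrite e'u normc_sqr /= expr0n addr0 Me.
  have -> : sqnorm (e - z *: u) = s * sqnorm u by rewrite divfK // sqnorm_eq0.
  by rewrite mulrAC expr2 ler_pM2r.
(* M w = 0 makes w a multiple of G w, so G w does not vanish. *)
move: Mu; rewrite -unitmx_tr -row_free_unit -kermx_eq0 => /rowV0Pn [w /sub_kermxP Mw w0].
have {}Mw : M *m w^T = 0 by rewrite -[M]trmxK -trmx_mul Mw trmx0.
exists w^T; last by rewrite Mw /sqnorm {1}/inner mulmx0 mxtrace0 mulr_ge0 ?sqnorm_ge0.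
apply: contraNneq w0 => Gw; move: Mw.
rewrite mulmxBl mul1mx -scalemxAl Gw scaler0 subr0.
by move=> /(canRL (@trmxK _ _ _)) ->; rewrite trmx0.
Qed.

(** By [sqnorm_two_sided] one of [D u] and [D^* u] has a small quotient; in the
    second case [bound_quotient_adj] moves it from [G^*] to [G]. *)
Lemma bound_quotient_witness n (G D : 'M[C]_n) (u : 'cV[C]_n) : u != 0 ->
  G *m (D *m u) = u -> G ^t* *m (D ^t* *m u) = u ->
  exists2 v : 'cV[C]_n, G *m v != 0 & bound_quotient v (G *m v) <= sqnorm D.
Proof.
move=> u0 Ga Ge; have avg := sqnorm_two_sided D u0.
have [le_a|lt_a] := leP (bound_quotient (D *m u) u) (sqnorm D).
  by exists (D *m u); rewrite Ga.
have e0 : G ^t* *m (D ^t* *m u) != 0 by rewrite Ge.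
have [v Gv0 qv] := bound_quotient_adj e0.
exists v; first exact: Gv0.
apply: le_trans qv _; rewrite Ge.
move: (bound_quotient _ _) (bound_quotient _ _) (sqnorm D) avg lt_a.
by clear => qa qe d; lra.
Qed.

(** * Spectral and order-theoretic preliminaries *)

(** A zero of the form [<x, P x>] is a minimum, so the gradient [P x] of the form
    vanishes there: otherwise a short step along [- P x] would make it negative. *)
Lemma psd_kernel n (P : 'M[C]_n) (x : 'cV[C]_n) : possemidefmx P ->
  complex.Re (inner x (P *m x)) = 0 -> P *m x = 0.
Proof.
move=> [Ph Pge] x0; set y := P *m x.
apply/eqP; apply/contraT; rewrite -sqnorm_gt0 => h0.
have Re_ge (z : 'cV[C]_n) : 0 <= complex.Re (inner z (P *m z)).
  by have := Pge z; rewrite formE lecE => /andP[].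
set k := complex.Re (inner y (P *m y)).
have k0 : 0 <= k := Re_ge y.
(* The form along x - t y is t (t k - 2 |y|^2); adding 1 keeps the denominator
   of this near-optimal step positive when k = 0. *)
set t := sqnorm y / (k + 1); set z := x - t%:C%C *: y.
have Pz : P *m z = y - t%:C%C *: (P *m y) by rewrite mulmxBr -scalemxAr.
have zy : inner z y = (inner x y - t%:C%C * (sqnorm y)%:C%C).
  rewrite innerC innerBr innerZr inner_sqnorm (innerC y x); case: (inner x y) => a b.
  by apply/eqP; rewrite eq_complex /=; apply/andP; split; apply/eqP; ring.
have zPy : inner z (P *m y) = (sqnorm y)%:C%C - t%:C%C * (inner y (P *m y))^*%C.
  rewrite -{1}Ph -inner_mull Pz innerC innerBr innerZr inner_sqnorm; case: (inner y _) => a b.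
  by apply/eqP; rewrite eq_complex /=; apply/andP; split; apply/eqP; ring.
have := Re_ge z; rewrite Pz innerBr innerZr zy zPy.
have -> : complex.Re (inner x y - t%:C%C * (sqnorm y)%:C%C -
    t%:C%C * ((sqnorm y)%:C%C - t%:C%C * (inner y (P *m y))^*%C)) =
    t * (t * k - 2 * sqnorm y).
  move: x0; rewrite /k -/y; case: (inner x y) => a b /= ->.
  by case: (inner y _) => c d /=; ring.
have kp : 0 < k + 1 by rewrite ltr_wpDl.
have t0 : 0 < t by exact: divr_gt0 h0 kp.
rewrite pmulr_rge0 // subr_ge0.
have -> : sqnorm y = t * (k + 1) by rewrite divfK ?gt_eqF.
clear zy zPy Pz z; rewrite mulrDr mulr1.
have := mulr_ge0 (ltW t0) k0; move: (t * k) t0; clearbody t => a b.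
by clear -a b; lra.
Qed.

(** A matrix and its transpose are singular together, so the row eigenvectors
    behind [eigenvalue] can be traded for columns. *)
Lemma col_eigenvector n (A : 'M[C]_n) (z : C) : eigenvalue A z ->
  exists2 x : 'cV[C]_n, A *m x = z *: x & x != 0.
Proof.
rewrite /eigenvalue /eigenspace kermx_eq0 row_free_unit -unitmx_tr.
rewrite -row_free_unit -kermx_eq0 => /rowV0Pn [v /sub_kermxP vA v0]; exists v^T.
  apply/subr0_eq; rewrite -mul_scalar_mx -mulmxBl.
  by apply: trmx_inj; rewrite trmx_mul trmxK vA trmx0.
by apply: contraNneq v0 => /(congr1 trmx); rewrite trmxK trmx0 => ->.
Qed.

Lemma stable_shifted_unit n (J R Q : 'M[C]_n) (w : K) :
  asymptotically_stable ((J - R) *m Q) -> shifted J R Q w \in unitmx.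
Proof.
move=> st; rewrite -row_free_unit -kermx_eq0; apply/rowV0Pn => -[v /sub_kermxP vS v0].
have : spectrum ((J - R) *m Q) (0 +i* w)%C.
  apply/eigenvalueP; exists v => //; move: vS.
  by rewrite mulmxBr mul_mx_scalar => /subr0_eq.
by move=> /st /=; rewrite ltxx.
Qed.

Lemma mpinv_mulV n r (B : 'M[C]_(n, r)) : \rank B = r -> mpinv B *m B = 1%:M.
Proof.
move=> hB; have [BXB _ _ _] := mpinvP B.
have Bf : row_full B by rewrite /row_full hB.
have [X XB] := row_fullP Bf.
by rewrite -XB -{3}BXB !mulmxA XB mul1mx.
Qed.

(** Squaring is monotone on [[0, +oo]], so a nonnegative [L] can be compared
    through its square root; a negative [L] is below every square. *)
Lemma le_ereal_inf_sqr (A : set K) (L : \bar K) :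
  (forall t, A t -> 0 <= t /\ (L <= (t ^+ 2)%:E)%E) ->
  (L <= ereal_inf [set t%:E | t in A] ^+ 2)%E.
Proof.
move=> LA; have [L0|/ltW L0] := leP 0%E L; last exact: le_trans L0 (sqre_ge0 _).
rewrite -(sqr_sqrte L0) lee_sqr ?sqrte_ge0 //; last first.
  by apply/ereal_infP => _ [t At <-]; rewrite lee_fin; have [] := LA t At.
apply/ereal_infP => _ [t At <-]; have [t0 Lt] := LA t At.
by apply: lee_sqrE; rewrite ?lee_fin // sqr_sqrte // -EFin_expe.
Qed.

(** * Perturbed eigenvectors and the transfer matrix *)

(** The value at [i w] of the transfer function of the port-Hamiltonian system
    [x' = (J - R) Q x + B v] with output [B^* Q x]. *)
Definition transfer n r (J R Q : 'M[C]_n) (B : 'M[C]_(n, r)) (w : K) : 'M[C]_r :=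
  B ^t* *m Q *m invmx (shifted J R Q w) *m B.

Section Perturbation.
Variables (n r : nat) (J R Q : 'M[C]_n) (B : 'M[C]_(n, r)) (w : K).
Hypotheses (hJ : J ^t* = - J) (hR : R ^t* = R) (hQ : Q ^t* = Q).
Hypothesis hS : shifted J R Q w \in unitmx.
Local Notation S := (shifted J R Q w).
Local Notation G := (transfer J R Q B w).

Lemma shifted_adj : S ^t* = - (0 +i* w)%C%:M + Q *m (J + R).
Proof.
rewrite /shifted linearB /= map_mxB tr_scalar_mx map_scalar_mx; congr (_ + _).
  rewrite -[RHS]raddfN; congr (_%:M).
  by apply/eqP; rewrite eq_complex /= oppr0 !eqxx.
by rewrite trmxC_mul linearB /= map_mxB hJ hR hQ -mulmxN opprB opprK addrC.
Qed.

Lemma transfer_adj : G ^t* = B ^t* *m (invmx S) ^t* *m Q *m B.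
Proof. by rewrite /transfer !trmxC_mul trmxCK hQ !mulmxA. Qed.

(** Since [S x = B D u], applying [S^-1] and [B^* Q] gives the first relation.  For
    the second, the real part of [<Q x, i w x>], which is zero because [Q] is
    Hermitian, shows that [R + B D2 B^*] kills [Q x] by [psd_kernel]; then flipping
    the sign of the dissipative part in the eigenvector equation turns it into
    [S^* Q x = Q B D^* u]. *)
Lemma perturbed_eigenvector (D1 D2 : 'M[C]_r) (x : 'cV[C]_n) (u := B ^t* *m Q *m x) :
  Sd J R B (D1, D2) ->
  ((J - R) *m Q + B *m (D1 - D2) *m B ^t* *m Q) *m x = (0 +i* w)%C *: x ->
  x != 0 ->
  [/\ u != 0, G *m ((D1 - D2) *m u) = u
    & G ^t* *m ((D1 - D2) ^t* *m u) = u].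
Proof.
move=> [/= hD1 [hD2 _] hP] Mx x0.
have Sx : S *m x = B *m ((D1 - D2) *m u).
  rewrite /shifted mulmxBl mul_scalar_mx -Mx mulmxDl addrAC subrr add0r.
  by rewrite /u !mulmxA.
have xE : x = invmx S *m (B *m ((D1 - D2) *m u)) by rewrite -Sx mulKmx.
have Py0 : R *m Q *m x + B *m (D2 *m u) = 0.
  have Pu : R *m Q *m x + B *m (D2 *m u) = (R + B *m D2 *m B ^t*) *m (Q *m x).
    by rewrite /u mulmxDl !mulmxA.
  rewrite Pu; apply: psd_kernel => //.
  (* Solving the eigenvector equation for the dissipative part. *)
  have -> : (R + B *m D2 *m B ^t*) *m (Q *m x)
      = (J + B *m D1 *m B ^t*) *m (Q *m x) - (0 +i* w)%C *: x.
    rewrite -Mx !(mulmxDl, mulmxBl, mulmxBr) !mulmxA.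
    by rewrite !mulNmx opprD addrACA !subKr.
  rewrite innerBr innerZr raddfB /= skew_form.
    by have := herm_form x hQ; case: (inner _ _) => a b /= ->; ring.
  by rewrite linearD /= map_mxD !trmxC_mul trmxCK hJ hD1 mulNmx mulmxN opprD mulmxA.
split.
- apply: contraNneq x0 => u0.
  by rewrite xE u0 !mulmx0.
- by rewrite /transfer -!mulmxA -xE /u mulmxA.
have SQx : S ^t* *m (Q *m x) = Q *m (B *m ((D1 - D2) ^t* *m u)).
  have uE : B ^t* *m (Q *m x) = u by rewrite mulmxA.
  rewrite shifted_adj mulmxDl mulNmx mul_scalar_mx scalemxAr -Mx -!mulmxA.
  rewrite -mulmxN -mulmxDr; congr (Q *m _).
  have -> : (D1 - D2) ^t* = - D1 - D2 by rewrite linearB /= map_mxB hD1 hD2.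
  have Rx : R *m (Q *m x) = - (B *m (D2 *m u)).
    by apply/eqP; rewrite -addr_eq0 mulmxA Py0.
  rewrite !(mulmxDl, mulmxBl, mulmxBr, mulNmx, mulmxN) -!mulmxA Rx uE.
  by rewrite opprK addrACA subrr addr0 opprD addrACA addNr add0r.
rewrite transfer_adj -!mulmxA -SQx [X in B ^t* *m X]mulmxA -trmxC_mul.
by rewrite mulmxV // trmx1 map_mx1 mul1mx /u mulmxA.
Qed.

(** The point [x = S^-1 B v] lies in [Omega] because [S x] is in the range of [B]. *)
Lemma objective_transfer (v : 'cV[C]_r) (x := invmx S *m (B *m v)) :
  mpinv B *m B = 1%:M ->
  [/\ Omega J R Q B w x, B ^t* *m Q *m x = G *m v
    & 2 * eucl_norm (mpinv B *m S *m x) ^+ 2 / eucl_norm (B ^t* *m Q *m x) ^+ 2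
      - Normc.normc ((x ^t* *m Q *m S *m x) 0 0) ^+ 2
        / eucl_norm (B ^t* *m Q *m x) ^+ 4 = bound_quotient v (G *m v)].
Proof.
move=> XB; have Sx : S *m x = B *m v by rewrite mulKVmx.
have Gv : B ^t* *m Q *m x = G *m v by rewrite /transfer -!mulmxA.
split=> //.
- rewrite /Omega /null /= -mulmxA Sx mulmxBl mul1mx -!mulmxA.
  by rewrite [mpinv B *m _]mulmxA XB mul1mx subrr.
rewrite Gv -[X in X ^+ 4]/(eucl_norm _) (exprM _ 2 2) !eucl_norm_sqr.
rewrite -[mpinv B *m S *m x]mulmxA Sx mulmxA XB mul1mx.
rewrite -[_ *m S *m x]mulmxA Sx.
suff -> : (x ^t* *m Q *m (B *m v)) 0 0 = inner (G *m v) v by [].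
by rewrite -Gv -!mulmxA inner_scalar mxE mulr1n !inner_mull trmxCK hQ.
Qed.

End Perturbation.

End StructuredPerturbation.

(** * The lower bound *)

Theorem theorem5p5 (K : realType) (n r : nat)
    (J R Q : 'M[K[i]]_n) (B : 'M[K[i]]_(n, r))
    (hJ : J ^t* = - J) (hR : possemidefmx R) (hQ : posdefmx Q)
    (hstab : asymptotically_stable ((J - R) *m Q))
    (hB : \rank B = r)
    (hOmega : exists w : K, Omega J R Q B w <> [set 0]) :
  (ereal_inf [set
       ereal_inf [set
           (2 * eucl_norm (mpinv B *m shifted J R Q w *m x) ^+ 2
              / eucl_norm (B ^t* *m Q *m x) ^+ 2
            - Normc.normc ((x ^t* *m Q *m shifted J R Q w *m x) 0 0) ^+ 2
              / eucl_norm (B ^t* *m Q *m x) ^+ 4)%R%:E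
         | x in [set x : 'cV[K[i]]_n |
                  Omega J R Q B w x /\ B ^t* *m Q *m x != 0%R]]
     | w in [set: K]]
   <= stab_radius_Sd J R Q B ^+ 2)%E.
Proof.
have [[hRh _] [hQh _]] := (hR, hQ).
rewrite /stab_radius_Sd -(image_comp _ EFin).
apply: le_ereal_inf_sqr => _ [[D1 D2] [DS [[a w] [Mz a0]]] <-].
split; first exact: sqrtr_ge0.
rewrite sqr_sqrtr ?addr_ge0 ?sqr_ge0 // !frob_norm_sqr /=.
have {}a0 : a = 0 := a0; subst a.
have S_unit := stable_shifted_unit w hstab.
have [x Mx x0] := col_eigenvector Mz.
have [u0 Ga Ge] := perturbed_eigenvector hJ hRh hQh S_unit DS Mx x0.
have [v Gv0 qv] := bound_quotient_witness u0 Ga Ge.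
have [/= hD1 [hD2 _] _] := DS.
have [Ox Gx obj] := objective_transfer hQh S_unit v (mpinv_mulV hB).
apply: ge_ereal_inf; eexists; first by exists w.
apply: ge_ereal_inf; eexists.
  by eexists; first split; [exact: Ox|by rewrite Gx|reflexivity].
by rewrite obj lee_fin -sqnorm_skew_herm.
Qed.
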